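(* Let $F$ be a field, let $e>1$ be an integer, and let $\zeta_{2^e}$ be a primitive $2^e$-th root of unity in an algebraic closure of $F$. If $[F(\zeta_{2^e}):F]=2$, then $\operatorname{o}_F(\zeta_{2^e})\in\{2,2^{e-1}\}$.
   Context: $\operatorname{o}_F(\alpha)$, the order of $\alpha$ over $F$, is the least integer $k\ge1$ such that $\alpha^k\in F$. Whenever a primitive $n$-th root of unity is written, it is implicitly assumed that $\operatorname{char}F\nmid n$ (so here $\operatorname{char}F\neq2$). *)

(* Defs.v *)
From mathcomp Require Import all_boot all_algebra.

Set Implicit Arguments.
Unset Strict Implicit.
Unset Printing Implicit Defensive.

Import GRing.Theory.
Local Open Scope ring_scope.

(* The base field F is arbitrary, so its algebraic closure L is in general not
   a fieldExtType F (which is finite dimensional): F is embedded in L by a ring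
   morphism iota, and subfields of L are Prop-valued predicates, since
   membership in F(z), or even in F, need not be decidable. *)

Definition algebraic_closure (F : fieldType) (L : closedFieldType)
    (iota : {rmorphism F -> L}) : Prop :=
  forall x : L, algebraicOver iota x.

Definition is_subfield (L : fieldType) (S : L -> Prop) : Prop :=
  [/\ S 1, forall x y, S x -> S y -> S (x - y)
         & forall x y, S x -> S y -> S (x / y)].

Definition in_base (F L : fieldType) (iota : {rmorphism F -> L}) (x : L) : Prop :=
  exists a : F, x = iota a.

Definition adjoin (F L : fieldType) (iota : {rmorphism F -> L}) (z x : L) : Prop :=
  forall S : L -> Prop,
    is_subfield S -> (forall a, S (iota a)) -> S z -> S x.

(* [K : F] = n, for K a subfield of L containing F. *)
Definition has_degree (F L : fieldType) (iota : {rmorphism F -> L})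
    (K : L -> Prop) (n : nat) : Prop :=
  exists b : 'I_n -> L,
    [/\ forall i, K (b i),
        forall c : 'I_n -> F,
          \sum_(i < n) iota (c i) * b i = 0 -> forall i, c i = 0
      & forall x, K x ->
          exists c : 'I_n -> F, x = \sum_(i < n) iota (c i) * b i].

(* k = o_F(x); a relation, because x may have no positive power in F. *)
Definition is_order_over (F L : fieldType) (iota : {rmorphism F -> L})
    (x : L) (k : nat) : Prop :=
  [/\ (1 <= k)%N, in_base iota (x ^+ k)
    & forall m : nat, (1 <= m)%N -> in_base iota (x ^+ m) -> (k <= m)%N].

(* Main.v *)
Require Import Defs.
From mathcomp Require Import all_boot all_algebra.
From mathcomp Require Import ring zify.
Import GRing.Theory.
Local Open Scope ring_scope.

(* The conjugate of z over F is again a 2^e-th root of unity, say z^s, and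
   conjugating twice gives s^2 = 1 mod 2^e, with s <> 1 because z is not in F.
   A power z^k lies in F iff conjugation fixes it, i.e. iff s k = k mod 2^e.
   Writing s = 2 t + 1, the first condition says that 2^(e-2) divides t (t + 1),
   and the second that 2^(e-1) divides t k. Hence either t = 2^(e-2), and the
   order is 2, or t is odd, and the order is 2^(e-1). *)

Section QuadraticPowers.

Set Implicit Arguments.
Unset Strict Implicit.
Unset Printing Implicit Defensive.

Variables (F L : fieldType) (iota : {rmorphism F -> L}) (z : L).

Lemma in_base_subfield : is_subfield (in_base iota).
Proof.
split; first by exists 1; rewrite rmorph1.
- by move=> _ _ [a ->] [b ->]; exists (a - b); rewrite rmorphB.
- by move=> _ _ [a ->] [b ->]; exists (a / b); rewrite fmorph_div.
Qed.

Lemma adjoin_subfield : is_subfield (adjoin iota z).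
Proof.
split=> [S [S1 _ _] _ _ //|x y Kx Ky S SS Sb Sz|x y Kx Ky S SS Sb Sz].
- by case: (SS) => _ SB _; apply: SB; [apply: Kx | apply: Ky].
- by case: (SS) => _ _ SV; apply: SV; [apply: Kx | apply: Ky].
Qed.

Lemma adjoin_gen : adjoin iota z z.
Proof. by []. Qed.

Lemma adjoin_sqr : adjoin iota z (z ^+ 2).
Proof.
have [K1 _ KV] := adjoin_subfield.
have Kz := adjoin_gen.
(* [is_subfield] offers division but no product, so the square is reached as [z / (1 / z)]. *)
have KzV : adjoin iota z (1 / z) by apply: KV.
by have := KV _ _ Kz KzV; rewrite div1r invrK.
Qed.

(** If [z] were in F, both basis vectors would be in F, where [b1 * b0 - b0 * b1 = 0] is a linear
    relation between them. *)
Lemma degree2_notin_base :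
  has_degree iota (adjoin iota z) 2 -> ~ in_base iota z.
Proof.
move=> [b [Kb free_b _]] zF.
have bF i : in_base iota (b i).
  exact: Kb i _ in_base_subfield (fun a => ex_intro _ a (erefl _)) zF.
have [[b0 Eb0] [b1 Eb1]] := (bF ord0, bF (lift ord0 ord0)).
pose c (x y : F) (i : 'I_2) := if i == ord0 then x else y.
have b1_0 : b1 = 0.
  apply: (free_b (c b1 (- b0)) _ ord0).
  by rewrite big_ord_recl big_ord1 Eb0 Eb1 /c /= rmorphN; ring.
suff /eqP : (1 : F) = 0 by rewrite oner_eq0.
apply: (free_b (c 0 1) _ (lift ord0 ord0)).
by rewrite big_ord_recl big_ord1 Eb1 b1_0 /c /= !rmorph0 mulr0 mul0r addr0.
Qed.

Hypothesis zNF : ~ in_base iota z.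

Lemma linear_coef_unique (p q p' q' : F) :
  iota p + iota q * z = iota p' + iota q' * z -> p = p' /\ q = q'.
Proof.
move=> E; have Eq : q = q'.
  apply/eqP/negP => /negP neq_q; apply: zNF; exists ((p' - p) / (q - q')).
  rewrite fmorph_div !rmorphB; apply: (canRL (mulfK _)); last first.
    by rewrite mulrBr mulrC (mulrC z) -[_ * z](addrK (iota p)) [_ * z + _]addrC E; ring.
  by rewrite -rmorphB fmorph_eq0 subr_eq0.
by split=> //; move: E; rewrite Eq => /addIr/fmorph_inj.
Qed.

Lemma degree2_quadratic :
  has_degree iota (adjoin iota z) 2 ->
  exists a b : F, z ^+ 2 = iota a + iota b * z.
Proof.
move=> [v [_ _ span_v]].
have [K1 _ _] := adjoin_subfield.
have [c Ec] := span_v _ K1.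
have [d Ed] := span_v _ adjoin_gen.
have [f Ef] := span_v _ adjoin_sqr.
move: Ec Ed Ef; rewrite !big_ord_recl !big_ord0 !addr0.
move: (c _) (c _) (d _) (d _) (f _) (f _) (v _) (v _).
move=> {c d f v span_v} c0 c1 d0 d1 f0 f1 v0 v1 Ec Ed Ef.
(* Cramer's rule: [D] is the determinant of the coordinates of 1 and [z] in the basis [v0], [v1].
   Inverting it rewrites [z ^+ 2] in terms of 1 and [z]. *)
pose D := c0 * d1 - c1 * d0.
have Ev0 : iota D * v0 = iota d1 - iota c1 * z.
  by rewrite -[iota d1]mulr1 Ec Ed /D !(rmorphB, rmorphM) /=; ring.
have Ev1 : iota D * v1 = iota c0 * z - iota d0.
  by rewrite -[iota d0]mulr1 Ec Ed /D !(rmorphB, rmorphM) /=; ring.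
have [D0 | D_neq0] := eqVneq D 0.
  (* Independence of 1 and [z] then kills both coordinates of 1, so 1 = 0. *)
  move: Ev0 Ev1; rewrite D0 rmorph0 !mul0r => E0 E1.
  have [_ c1_0] : d1 = 0 /\ - c1 = 0.
    by apply: linear_coef_unique; rewrite !rmorph0 rmorphN mulNr -E0; ring.
  have [_ c0_0] : - d0 = 0 /\ c0 = 0.
    by apply: linear_coef_unique; rewrite !rmorph0 rmorphN addrC -E1; ring.
  move: Ec; rewrite c0_0 -[c1]opprK c1_0 oppr0 !rmorph0 !mul0r addr0.
  by move/eqP; rewrite oner_eq0.
exists ((f0 * d1 - f1 * d0) / D), ((f1 * c0 - f0 * c1) / D).
have iD_neq0 : iota D != 0 by rewrite fmorph_eq0.
apply: (mulfI iD_neq0).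
have scaleD x : iota D * iota (x / D) = iota x by rewrite -rmorphM mulrC divfK.
rewrite Ef [RHS]mulrDr [in RHS]mulrA !scaleD.
rewrite mulrDr !(mulrCA (iota D)) Ev0 Ev1 !(rmorphB, rmorphM) /=.
by ring.
Qed.

Variables (a b : F).

(** [p + q X] is the remainder of [X ^ m] modulo [X ^ 2 - b X - a]. It is chosen before the root
    [w], so that one pair serves both conjugates. *)
Lemma expr_linear (m : nat) : exists p q : F, forall w : L,
  w ^+ 2 = iota a + iota b * w -> w ^+ m = iota p + iota q * w.
Proof.
elim: m => [|m [p [q IH]]].
  by exists 1, 0 => w _; rewrite rmorph0 rmorph1 mul0r addr0.
exists (q * a), (p + q * b) => w Ew.
rewrite exprSr IH // mulrDl -mulrA -expr2 Ew !(rmorphD, rmorphM) /=.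
by ring.
Qed.

Hypothesis Ez : z ^+ 2 = iota a + iota b * z.

(** The conjugate of [z]: the two roots of [X ^ 2 - b X - a] add up to [b]. *)
Let w := iota b - z.

Lemma conj_quadratic : w ^+ 2 = iota a + iota b * w.
Proof.
have -> : w ^+ 2 = iota b ^+ 2 - iota b * z *+ 2 + z ^+ 2 by rewrite /w; ring.
by rewrite Ez /w; ring.
Qed.

(** This replaces the conjugation automorphism, which is never constructed: coefficients over 1, [z]
    are unique, so they are those of the common remainder. *)
Lemma conj_expr (m : nat) (p q : F) :
  z ^+ m = iota p + iota q * z -> w ^+ m = iota p + iota q * w.
Proof.
have [p' [q' E]] := expr_linear m.
by rewrite E // => /linear_coef_unique[<- <-]; apply/E/conj_quadratic.
Qed.

Lemma expr_in_base_conj (m : nat) :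
  (2%:R : F) != 0 -> in_base iota (z ^+ m) <-> w ^+ m = z ^+ m.
Proof.
move=> two_neq0; split=> [[c Ec] | Ewz].
  have := @conj_expr m c 0; rewrite Ec rmorph0 !mul0r addr0.
  by move=> /(_ erefl).
have [p [q E]] := expr_linear m.
(* Separability: [w = z] would give [z = b / 2], an element of F. *)
have w_neq_z : w - z != 0.
  rewrite subr_eq0; apply/eqP => wz; apply: zNF; exists (b / 2%:R).
  rewrite fmorph_div rmorph_nat; apply: (canRL (mulfK _)).
    by rewrite -(rmorph_nat iota) fmorph_eq0.
  by rewrite -[iota b](subrK z) -/w wz; ring.
have: iota q * (w - z) = 0.
  have := E _ conj_quadratic; rewrite Ewz (E _ Ez) => /addrI E'.
  by rewrite mulrBr E' subrr.
move/eqP; rewrite mulf_eq0 (negPf w_neq_z) orbF => /eqP q0.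
by exists p; rewrite (E _ Ez) q0 mul0r addr0.
Qed.

Lemma conj_primitive_root (n : nat) :
  n.-primitive_root z ->
  exists s : 'I_n, w = z ^+ s /\ (s * s = 1 %[mod n])%N.
Proof.
move=> prim_z.
have wn1 : w ^+ n = 1.
  have := @conj_expr n 1 0; rewrite (prim_expr_order prim_z).
  by rewrite rmorph0 rmorph1 !mul0r addr0 => /(_ erefl).
have [s Es] := prim_rootP prim_z wn1.
exists s; split=> //; apply/eqP.
rewrite -(eq_prim_root_expr prim_z) exprM -Es expr1.
(* Conjugating [z ^+ s = b - z] gives [w ^+ s = b - w = z]. *)
have := @conj_expr s b (- 1); rewrite -Es rmorphN rmorph1 !mulN1r => ->//.
by rewrite /w subKr.
Qed.

End QuadraticPowers.

Section PowersOfTwo.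

Set Implicit Arguments.

(** One of [t], [t.+1] is odd, so the power of 2 dividing their product divides the other. *)
Lemma sqr_eq1_mod_pow2 (e s : nat) :
  (1 < e)%N -> (s < 2 ^ e)%N -> (s * s = 1 %[mod 2 ^ e])%N ->
  exists t : nat, [/\ s = t.*2.+1, (t < 2 ^ (e - 1))%N
    & (2 ^ (e - 2) %| t)%N || (2 ^ (e - 2) %| t.+1)%N].
Proof.
(* From here [e] denotes the original exponent minus 2. *)
case: e => [//|[//|e]] _; rewrite !subSS !subn0 => lt_s /eqP Es.
have s_gt0 : (0 < s)%N.
  by case: s lt_s Es => // _; rewrite mul0n mod0n modn_small // !expnS; lia.
rewrite eqn_mod_dvd ?muln_gt0 ?s_gt0 // in Es.
have odd_s : odd s.
  have: (2 %| s * s - 1)%N by apply: dvdn_trans Es; rewrite dvdn_exp.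
  by rewrite dvdn2 oddB ?muln_gt0 ?s_gt0 // oddM; case: (odd s).
exists s./2; have Hs : s = s./2.*2.+1 by rewrite -[LHS]odd_double_half odd_s.
split=> //; first by move: lt_s; rewrite [in X in X -> _]Hs expnS; lia.
move: (s./2) Hs Es => t -> {s lt_s s_gt0 odd_s}.
have -> : (t.*2.+1 * t.*2.+1 - 1 = 2 ^ 2 * (t * t.+1))%N by lia.
rewrite -(addn2 e) addnC expnD dvdn_pmul2l // => dvd_tt.
have [odd_t | even_t] := boolP (odd t).
  by rewrite Gauss_dvdr ?coprimeXl ?coprime2n // in dvd_tt; rewrite dvd_tt orbT.
by rewrite Gauss_dvdl ?coprimeXl ?coprime2n //= in dvd_tt; rewrite dvd_tt.
Qed.

Lemma pow2_dvd_mul_half (e t : nat) :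
  (1 < e)%N -> (0 < t < 2 ^ (e - 1))%N ->
  (2 ^ (e - 2) %| t)%N || (2 ^ (e - 2) %| t.+1)%N ->
  exists2 k : nat, k \in [:: 2; 2 ^ (e - 1)]%N
    & forall m : nat, (2 ^ (e - 1) %| t * m)%N = (k %| m)%N.
Proof.
case: e => [//|[//|e]] _; rewrite !subSS !subn0 => /andP[t_gt0 lt_t].
have [/dvdnP[u Et] _ | ndvd_t /= dvd_t1] := boolP (2 ^ e %| t)%N.
  exists 2%N; first by rewrite inE eqxx.
  (* The bounds on [t] leave [u = 1] as the only multiple. *)
  have -> : t = (2 ^ e)%N.
    move: lt_t t_gt0; rewrite Et expnS ltn_pmul2r ?expn_gt0 // muln_gt0.
    by case: u {Et} => [|[|u]] //; rewrite mul1n.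
  by move=> m; rewrite expnSr dvdn_pmul2l // expn_gt0.
exists (2 ^ e.+1)%N; first by rewrite !inE eqxx orbT.
(* Since [2 ^ e] does not divide [t], it is not 1; hence [t.+1] is even and [t] is coprime to 2. *)
case: e lt_t ndvd_t dvd_t1 => [|e] _ ndvd_t dvd_t1 m; first by rewrite dvd1n in ndvd_t.
have odd_t : odd t.
  by have := dvdn_trans (dvdn_exp _ (dvdnn 2)) dvd_t1; rewrite dvdn2 /= negbK => ->.
by rewrite Gauss_dvdr // coprimeXl // coprime2n.
Qed.

End PowersOfTwo.

Theorem theorem2p5 (F : fieldType) (L : closedFieldType)
    (iota : {rmorphism F -> L}) (Lclosure : algebraic_closure iota)
    (e : nat) (e_gt1 : (1 < e)%N) (charF : 2%N \notin [pchar F])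
    (z : L) (prim_z : (2 ^ e)%N.-primitive_root z)
    (deg2 : has_degree iota (adjoin iota z) 2) :
  exists2 k : nat,
    is_order_over iota z k & k \in [:: 2; 2 ^ (e - 1)]%N.
Proof.
have two_neq0 : (2%:R : F) != 0 by move: charF; rewrite inE.
have zNF := degree2_notin_base deg2.
have [a [b Ez]] := degree2_quadratic zNF deg2.
have [s [Ew Ess]] := conj_primitive_root zNF Ez prim_z.
have [t [Es lt_t dvd_t]] := sqr_eq1_mod_pow2 e_gt1 (ltn_ord s) Ess.
have in_baseP m : in_base iota (z ^+ m) <-> (2 ^ (e - 1) %| t * m)%N.
  rewrite (expr_in_base_conj zNF Ez m two_neq0) Ew -exprM.
  have -> : (2 ^ (e - 1) %| t * m)%N = (z ^+ (s * m) == z ^+ m).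
    (* The exponents differ by [(s - 1) * m = 2 * (t * m)]; a factor 2 cancels against [2 ^ e]. *)
    rewrite (eq_prim_root_expr prim_z) Es eqn_mod_dvd ?leq_pmull //.
    rewrite mulSn addKn -mul2n -mulnA.
    by rewrite -{2}(subnK (ltnW e_gt1)) addn1 expnS dvdn_pmul2l.
  by split=> /eqP.
have t_gt0 : (0 < t)%N.
  (* [t = 0] would mean that conjugation fixes [z] itself. *)
  by rewrite lt0n; apply/eqP => t0; apply: zNF; apply/(in_baseP 1%N); rewrite t0.
have [|k k_in dvd_k] := pow2_dvd_mul_half e_gt1 _ dvd_t; first by rewrite t_gt0.
have k_gt0 : (0 < k)%N.
  by move: k_in; rewrite !inE => /orP[] /eqP-> //; rewrite expn_gt0.
exists k => //; split=> [//||m m_gt0 /in_baseP]; first by apply/in_baseP; rewrite dvd_k.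
by rewrite dvd_k; apply: dvdn_leq.
Qed.
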